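(* Let $X$ be a compact subset of a real normed vector space $(V,\|\cdot\|)$. For all $u,v\in\Delta(X)$, $$d_1(u,v)=d_2(u,v)=d_2^+(u,v)=d_3(u,v).$$
   Context: $E=\mathcal C(X)$ is the space of continuous real functions on $X$. $\Delta(X)$ is the set of Borel probability measures on $X$, and for $f\in E$ we write $u(f)=\int f\,du$. - $D_1=\{f\in E:\ \forall x,y\in X,\ \forall a,b\ge 0,\ af(x)-bf(y)\le\|ax-by\|\}$, and $d_1(u,v)=\sup_{f\in D_1}\big(u(f)-v(f)\big)$. - $D_2=\{(f,g)\in E\times E:\ \forall x,y\in X,\ \forall a,b\ge0,\ af(x)+bg(y)\le\|ax-by\|\}$, and $d_2(u,v)=\sup_{(f,g)\in D_2}\big(u(f)+v(g)\big)$. - For $\varepsilon>0$, $D_2^\varepsilon=\{(f,g)\in E\times E:\ \forall x,y\in X,\ \forall a,b\in[0,1],\ af(x)+bg(y)\le \varepsilon+\|ax-by\|\}$ and $d_2^\varepsilon(u,v)=\sup_{(f,g)\in D_2^\varepsilon}\big(u(f)+v(g)\big)$. Then $d_2^+(u,v)=\inf_{\varepsilon>0}d_2^\varepsilon(u,v)$. - $\mathcal M_3(u,v)$ is the set of finite positive Borel measures $\gamma$ on $X^2\times[0,1]^2$ such that for every $f\in E$: - $\int\lambda f(x)\,d\gamma(x,y,\lambda,\mu)=u(f)$, and - $\int\mu f(y)\,d\gamma(x,y,\lambda,\mu)=v(f)$. - $d_3(u,v)=\inf_{\gamma\in\mathcal M_3(u,v)}\int_{X^2\times[0,1]^2}\|\lambda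 x-\mu y\|\,d\gamma(x,y,\lambda,\mu)$. *)

(* Defs.v *)
From HB Require Import structures.
From mathcomp Require Import all_boot all_order all_algebra.
From mathcomp Require Import all_classical all_reals all_analysis.
Set Implicit Arguments. Unset Strict Implicit. Unset Printing Implicit Defensive.
Import Order.TTheory GRing.Theory Num.Theory numFieldNormedType.Exports.
Local Open Scope classical_set_scope.
Local Open Scope ring_scope.

Definition Borel (T : topologicalType) : Type := g_sigma_algebraType (@open T).

(* E = C(X): real functions continuous on X (values outside X are irrelevant) *)
Definition contX (R : realType) (V : normedModType R) (X : set V) :
  set (V -> R) := [set f | {within X, continuous f}].

Definition integX (R : realType) (V : normedModType R) (X : set V)
  (u : {measure set (Borel V) -> \bar R}) (f : V -> R) : \bar R :=
  (\int[u]_(x in (X : set (Borel V))) (f x)%:E)%E.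

(* Delta(X): Borel probability measures on X, i.e. Borel probability
   measures on V giving full mass to X *)
Definition Delta (R : realType) (V : normedModType R) (X : set V) :
  set (probability (Borel V) R) := [set u | u (X : set (Borel V)) = 1%E].

Definition D1 (R : realType) (V : normedModType R) (X : set V) : set (V -> R) :=
  [set f | contX X f /\
    forall x y, X x -> X y -> forall a b : R, 0 <= a -> 0 <= b ->
      a * f x - b * f y <= `|a *: x - b *: y| ].

Definition d1 (R : realType) (V : normedModType R) (X : set V)
  (u v : probability (Borel V) R) : \bar R :=
  ereal_sup [set (integX X u f - integX X v f)%E | f in D1 X].

Definition D2 (R : realType) (V : normedModType R) (X : set V) :
  set ((V -> R) * (V -> R)) :=
  [set fg | contX X fg.1 /\ contX X fg.2 /\
    forall x y, X x -> X y -> forall a b : R, 0 <= a -> 0 <= b ->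
      a * fg.1 x + b * fg.2 y <= `|a *: x - b *: y| ].

Definition d2 (R : realType) (V : normedModType R) (X : set V)
  (u v : probability (Borel V) R) : \bar R :=
  ereal_sup [set (integX X u fg.1 + integX X v fg.2)%E | fg in D2 X].

Definition D2eps (R : realType) (V : normedModType R) (X : set V) (eps : R) :
  set ((V -> R) * (V -> R)) :=
  [set fg | contX X fg.1 /\ contX X fg.2 /\
    forall x y, X x -> X y -> forall a b : R, 0 <= a <= 1 -> 0 <= b <= 1 ->
      a * fg.1 x + b * fg.2 y <= eps + `|a *: x - b *: y| ].

Definition d2eps (R : realType) (V : normedModType R) (X : set V) (eps : R)
  (u v : probability (Borel V) R) : \bar R :=
  ereal_sup [set (integX X u fg.1 + integX X v fg.2)%E | fg in D2eps X eps].

Definition d2plus (R : realType) (V : normedModType R) (X : set V)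
  (u v : probability (Borel V) R) : \bar R :=
  ereal_inf [set d2eps X eps u v | eps in [set eps : R | 0 < eps]].

(* the space X^2 x [0,1]^2, inside V * V * R * R;
   a point p encodes (x, y, lambda, mu) = (p.1.1.1, p.1.1.2, p.1.2, p.2) *)
Definition XXII (R : realType) (V : normedModType R) (X : set V) :
  set (Borel (V * V * R * R)%type) :=
  [set p | X p.1.1.1 /\ X p.1.1.2 /\ 0 <= p.1.2 <= 1 /\ 0 <= p.2 <= 1].

(* M_3(u,v): finite positive Borel measures on X^2 x [0,1]^2 (i.e. finite
   Borel measures on V*V*R*R vanishing outside X^2 x [0,1]^2) with the
   two marginal-type constraints *)
Definition M3 (R : realType) (V : normedModType R) (X : set V)
  (u v : probability (Borel V) R) :
  set {finite_measure set (Borel (V * V * R * R)%type) -> \bar R} :=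
  [set g | g (~` XXII X) = 0%E /\
    (forall f, contX X f ->
       (\int[g]_(p in XXII X) (p.1.2 * f p.1.1.1)%:E)%E = integX X u f) /\
    (forall f, contX X f ->
       (\int[g]_(p in XXII X) (p.2 * f p.1.1.2)%:E)%E = integX X v f)].

Definition d3 (R : realType) (V : normedModType R) (X : set V)
  (u v : probability (Borel V) R) : \bar R :=
  ereal_inf [set (\int[g]_(p in XXII X) (`|p.1.2 *: p.1.1.1 - p.2 *: p.1.1.2|)%:E)%E
            | g in M3 X u v].

(* Main.v *)
Require Import Defs.
From HB Require Import structures.
From mathcomp Require Import all_boot all_order all_algebra.
From mathcomp Require Import all_classical all_reals all_analysis.
From mathcomp Require Import measurable_realfun lra.
Import Order.TTheory GRing.Theory Num.Theory numFieldNormedType.Exports.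
Set Implicit Arguments. Unset Strict Implicit. Unset Printing Implicit Defensive.
Local Open Scope classical_set_scope.
Local Open Scope ring_scope.

(** The chain d1 <= d2 <= d2+ <= d3 is direct: [(f, -f)] is in [D2] for [f] in
    [D1], and integrating the constraint of [D2eps] against a plan bounds d2eps
    by the cost plus [eps] times the (finite) mass of the plan.

    For d3 <= d1, cut [X] into finitely many Borel cells of diameter at most
    [e] around points [x i] and replace [u], [v] by weights [p], [q] on these
    points.  The discrete problem is to minimise
    [sum_ij `|a i j *: x i - b i j *: x j|] over nonnegative [a], [b] with row
    sums [p] and column sums [q].  Its value is a sublinear function of [(p, q)],
    which Hahn-Banach supports by some [(f, g)]; the inf-convolution
    [H z := inf_(j, t >= 0) (`|z - t *: x j| - t * g j)] is then positively
    homogeneous and 1-Lipschitz, hence in [D1], and satisfies [f i <= H (x i)]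
    and [g j <= - H (x j)], so [p.H - q.H] attains the discrete value.
    Conversely, a discrete plan lifts to one with marginals exactly [u] and [v]:
    over the pair [(i, j)], draw [(x, y)] from the product of the conditional
    laws of [u] and [v] in the cells [i] and [j], with [lambda = a i j] and
    [mu = b i j].  Both approximations cost [O(e)]. *)

(** * Sublinear functionals and Hahn-Banach for finitely many directions *)

Section sublinear.
Context {R : realType} {E : lmodType R}.
Implicit Types (N M : E -> R) (x y z : E).

Definition sublinear N :=
  (forall x y, N (x + y) <= N x + N y) /\
  (forall t x, 0 <= t -> N (t *: x) = t * N x).

Lemma sublinear0 N : sublinear N -> N 0 = 0.
Proof. by case=> _ NZ; rewrite -(scale0r 0) NZ// mul0r. Qed.

Lemma sublinear_oppr_ge N x : sublinear N -> - N (- x) <= N x.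
Proof.
move=> sN; have := sN.1 x (- x); rewrite subrr sublinear0//; lra.
Qed.

(** The one-step device of Hahn-Banach: for sublinear [N] this is the largest sublinear minorant of
    [N] whose value at [- z] is at most [- N z]. *)
Definition slope_inf N z x :=
  inf [set N (x + t *: z) - t * N z | t in [set t : R | 0 <= t]].

(** The lower bound [- N (- x)] comes from splitting [t *: z] as [- x + (x + t *: z)]. *)
Lemma slope_inf_has_inf N z x : sublinear N ->
  has_inf [set N (x + t *: z) - t * N z | t in [set t : R | 0 <= t]].
Proof.
move=> sN; split; first by exists (N (x + 0 *: z) - 0 * N z); exists 0 => /=.
exists (- N (- x)) => _ [t /= t0 <-].
by have := sN.1 (- x) (x + t *: z); rewrite addKr sN.2//; lra.
Qed.

Lemma slope_inf_le N z x t : sublinear N -> 0 <= t ->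
  slope_inf N z x <= N (x + t *: z) - t * N z.
Proof.
by move=> sN t0; apply: ge_inf; [exact: (slope_inf_has_inf _ _ sN).2|exists t].
Qed.

Lemma le_slope_inf N z x m : sublinear N ->
  (forall t, 0 <= t -> m <= N (x + t *: z) - t * N z) -> m <= slope_inf N z x.
Proof.
move=> sN h; apply: lb_le_inf; first exact: (slope_inf_has_inf _ _ sN).1.
by move=> _ [t /= t0 <-]; exact: h.
Qed.

Lemma slope_inf_le_id N z x : sublinear N -> slope_inf N z x <= N x.
Proof.
by move=> sN; have := slope_inf_le z x sN (lexx 0); rewrite scale0r addr0 mul0r subr0.
Qed.

Lemma slope_inf_oppr N z : sublinear N -> slope_inf N z (- z) <= - N z.
Proof.
move=> sN; have := slope_inf_le z (- z) sN ler01.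
by rewrite scale1r addNr mul1r sublinear0// sub0r.
Qed.

(** Parameters [r] for [x] and [s] for [y] combine into [r + s] for [x + y]; scaling by [t > 0]
    turns [s] into [t * s], a bijection of the admissible parameters. *)
Lemma sublinear_slope_inf N z : sublinear N -> sublinear (slope_inf N z).
Proof.
move=> sN; split=> [x y|t x].
  rewrite -lerBlDl; apply: le_slope_inf => // s s0.
  rewrite lerBlDl -lerBlDr; apply: le_slope_inf => // r r0.
  rewrite lerBlDr.
  apply: (le_trans (slope_inf_le z (x + y) sN (addr_ge0 r0 s0))).
  have := sN.1 (x + r *: z) (y + s *: z).
  by rewrite addrACA -scalerDl; lra.
rewrite le_eqVlt => /predU1P[<-|t0].
  rewrite scale0r mul0r; apply/eqP; rewrite eq_le; apply/andP; split.
    by rewrite -(sublinear0 sN); exact: slope_inf_le_id.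
  by apply: le_slope_inf => // s s0; rewrite add0r sN.2// subrr.
apply/eqP; rewrite eq_le; apply/andP; split.
  rewrite mulrC -ler_pdivrMr//; apply: le_slope_inf => // s s0.
  rewrite ler_pdivrMr//.
  apply: (le_trans (slope_inf_le z _ sN (mulr_ge0 (ltW t0) s0))).
  by rewrite -scalerA -scalerDr sN.2 ?(ltW t0)//; lra.
apply: le_slope_inf => // s s0.
have t'0 : 0 <= t^-1 * s by rewrite mulr_ge0// invr_ge0 ltW.
have := slope_inf_le z x sN t'0.
rewrite -(ler_pM2l t0) => /le_trans; apply.
rewrite mulrBr -(sN.2 t) ?(ltW t0)// scalerDr scalerA !mulrA.
by rewrite divff ?gt_eqF// !mul1r.
Qed.

(** One [slope_inf] per direction. Oddness once gained survives: if [M' <= M] are sublinear and [M]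
    is odd at [w], then [M' (- w) <= M (- w) = - M w <= - M' w], and the reverse inequality always
    holds. *)
Lemma sublinear_odd_on_seq N (s : seq E) : sublinear N ->
  exists M, [/\ sublinear M, forall x, M x <= N x &
    {in s, forall z, M (- z) = - M z}].
Proof.
move=> sN; elim: s => [|z s [M [sM MN Modd]]]; first by exists N.
have sM' := sublinear_slope_inf z sM.
exists (slope_inf M z); split=> //.
  by move=> x; exact: le_trans (slope_inf_le_id _ _ sM) (MN x).
move=> w ws; apply/eqP; rewrite eq_le; apply/andP; split; last first.
  by have := sublinear_oppr_ge w sM'; lra.
move: ws; rewrite inE => /predU1P[->|ws].
  have := slope_inf_oppr z sM; have := slope_inf_le_id z z sM; lra.
have := slope_inf_le_id z (- w) sM; have := slope_inf_le_id z w sM.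
by have := Modd _ ws; lra.
Qed.

(* Hahn-Banach on the span of a finite family. *)
Lemma sublinear_support N z0 (I : finType) (e : I -> E) : sublinear N ->
  exists f : I -> R, (forall c, \sum_i c i * f i <= N (\sum_i c i *: e i)) /\
    (forall c, z0 = \sum_i c i *: e i -> N z0 <= \sum_i c i * f i).
Proof.
move=> sN.
(* Starting from [slope_inf N z0] instead of [N] forces [M (- z0) <= - N z0], hence [N z0 <= M z0]:
   this is what makes the support touch [N] at [z0]. *)
have [M [sM MN Modd]] :=
  sublinear_odd_on_seq (codom e) (sublinear_slope_inf z0 sN).
have MZ c i : M (c *: e i) = c * M (e i).
  have [c0|c0] := leP 0 c; first exact: sM.2.
  have eE : M (- e i) = - M (e i) by apply: Modd; exact: codom_f.
  have := sM.2 (- c) (- e i); rewrite eE scalerN scaleNr opprK => ->; lra.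
have Mle c : M (\sum_i c i *: e i) <= \sum_i c i * M (e i).
  elim/big_ind2 : _ => [|x r y s xr ys|i _]; first by rewrite sublinear0.
    exact: le_trans (sM.1 _ _) (lerD xr ys).
  by rewrite MZ.
have Mge c : \sum_i c i * M (e i) <= M (\sum_i c i *: e i).
  have cN : \sum_i - c i *: e i = - \sum_i c i *: e i.
    by rewrite -sumrN; apply: eq_bigr => i _; rewrite scaleNr.
  have cMN : \sum_i - c i * M (e i) = - \sum_i c i * M (e i).
    by rewrite -sumrN; apply: eq_bigr => i _; rewrite mulNr.
  have := Mle (fun i => - c i); have := sublinear_oppr_ge (\sum_i c i *: e i) sM.
  by rewrite cN cMN; lra.
exists (fun i => M (e i)); split=> [c|c ez0].
  exact: le_trans (Mge c) (le_trans (MN _) (slope_inf_le_id _ _ sN)).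
apply: le_trans (Mle c); rewrite -ez0.
have := sublinear_oppr_ge z0 sM; have := MN (- z0).
by have := slope_inf_oppr z0 sN; lra.
Qed.

End sublinear.

(** * Duality for the discrete transport problem *)

Section homogeneous_duality.
Context {R : realType} {V : normedModType R} {I J : finType}.
Variables (x : I -> V) (y : J -> V).
Implicit Types (a b : I -> J -> R) (z : I + J -> R).

Definition plan_cost a b := \sum_i \sum_j `|a i j *: x i - b i j *: y j|.

(* The marginal constraints are relaxed to penalties so that the value is finite,
   hence sublinear, on all of [I + J -> R] and not only on the nonnegative cone. *)
Definition penalized_cost z a b := plan_cost a b
  + \sum_i `|z (inl i) - \sum_j a i j| * `|x i|
  + \sum_j `|z (inr j) - \sum_i b i j| * `|y j|.

Definition plans : set ((I -> J -> R) * (I -> J -> R)) :=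
  [set ab | forall i j, 0 <= ab.1 i j /\ 0 <= ab.2 i j].

Definition plan_inf z := inf [set penalized_cost z ab.1 ab.2 | ab in plans].

Lemma plan_cost_ge0 a b : 0 <= plan_cost a b.
Proof. by apply: sumr_ge0 => i _; apply: sumr_ge0 => j _. Qed.

Lemma penalized_cost_ge0 z a b : 0 <= penalized_cost z a b.
Proof.
rewrite /penalized_cost !addr_ge0 ?plan_cost_ge0//;
  by apply: sumr_ge0 => k _; rewrite mulr_ge0.
Qed.

Lemma plan_inf_le z a b : (forall i j, 0 <= a i j) -> (forall i j, 0 <= b i j) ->
  plan_inf z <= penalized_cost z a b.
Proof.
move=> a0 b0; apply: ge_inf; last by exists (a, b).
by exists 0 => _ [ab _ <-]; exact: penalized_cost_ge0.
Qed.

Lemma le_plan_inf z m : (forall a b, (forall i j, 0 <= a i j) ->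
  (forall i j, 0 <= b i j) -> m <= penalized_cost z a b) -> m <= plan_inf z.
Proof.
move=> h; apply: lb_le_inf.
  exists (penalized_cost z (fun _ _ => 0) (fun _ _ => 0)).
  by exists (fun _ _ => 0, fun _ _ => 0).
by move=> _ [[a b] /= ab0 <-]; apply: h => i j; have [] := ab0 i j.
Qed.

Lemma plan_costD a b a' b' :
  plan_cost (fun i j => a i j + a' i j) (fun i j => b i j + b' i j) <=
  plan_cost a b + plan_cost a' b'.
Proof.
rewrite /plan_cost -big_split ler_sum//= => i _.
rewrite -big_split ler_sum//= => j _.
apply: le_trans (ler_normD _ _).
by rewrite le_eqVlt; apply/orP; left; apply/eqP; congr `|_|;
  rewrite !scalerDl opprD addrACA.
Qed.

Lemma penalized_costD z z' a b a' b' :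
  penalized_cost (fun k => z k + z' k)
    (fun i j => a i j + a' i j) (fun i j => b i j + b' i j) <=
  penalized_cost z a b + penalized_cost z' a' b'.
Proof.
rewrite /penalized_cost; set A := plan_cost a b; set A' := plan_cost a' b'.
rewrite [leRHS]addrACA [X in _ <= X + _]addrACA !lerD ?plan_costD//.
- rewrite -big_split ler_sum//= => i _; rewrite -mulrDl ler_wpM2r//.
  by rewrite big_split opprD addrACA ler_normD.
- rewrite -big_split ler_sum//= => i _; rewrite -mulrDl ler_wpM2r//.
  by rewrite big_split opprD addrACA ler_normD.
Qed.

Lemma penalized_costZ t z a b : 0 <= t ->
  penalized_cost (fun k => t * z k) (fun i j => t * a i j) (fun i j => t * b i j)
  = t * penalized_cost z a b.
Proof.
move=> t0; rewrite /penalized_cost /plan_cost !mulrDr !mulr_sumr.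
congr (_ + _ + _); apply: eq_bigr => k _.
- rewrite mulr_sumr; apply: eq_bigr => j _.
  by rewrite -!scalerA -scalerBr normrZ ger0_norm.
- by rewrite -mulr_sumr -mulrBr normrM ger0_norm// mulrA.
- by rewrite -mulr_sumr -mulrBr normrM ger0_norm// mulrA.
Qed.

(** Plans form a convex cone and [penalized_cost] is jointly sublinear in [(z, a, b)]; minimising
    over [(a, b)] keeps sublinearity in [z]. *)
Lemma sublinear_plan_inf : @sublinear R (I + J -> R^o)%type plan_inf.
Proof.
have homle (t : R) z : 0 < t -> plan_inf (fun k => t * z k) <= t * plan_inf z.
  move=> t0; rewrite mulrC -ler_pdivrMr//; apply: le_plan_inf => a b a0 b0.
  rewrite ler_pdivrMr// mulrC -penalized_costZ ?(ltW t0)//.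
  by apply: plan_inf_le => i j; rewrite mulr_ge0// ltW.
split=> [z z'|t z].
  rewrite -lerBlDl; apply: le_plan_inf => a b a0 b0.
  rewrite lerBlDl -lerBlDr; apply: le_plan_inf => a' b' a'0 b'0.
  rewrite lerBlDr; apply: le_trans (penalized_costD z z' a' b' a b).
  apply: (@plan_inf_le (fun k => z k + z' k)).
    by move=> i j; rewrite addr_ge0.
  by move=> i j; rewrite addr_ge0.
rewrite le_eqVlt => /predU1P[<-|t0].
  rewrite mul0r scale0r; apply/eqP; rewrite eq_le; apply/andP; split.
    apply: (le_trans (@plan_inf_le _ (fun _ _ => 0) (fun _ _ => 0) _ _)) => //.
    rewrite /penalized_cost /plan_cost [X in X + _ + _]big1 ?add0r; last first.
      by move=> i _; rewrite big1// => j _; rewrite !scale0r subr0 normr0.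
    rewrite !big1 ?addr0// => k _; rewrite subr0 normr0.
      by rewrite mul0r.
    by rewrite mul0r.
  by apply: le_plan_inf => *; exact: penalized_cost_ge0.
apply/eqP; rewrite eq_le; apply/andP; split; first exact: homle.
rewrite mulrC -ler_pdivlMr// mulrC.
have t'0 : 0 < t^-1 by rewrite invr_gt0.
apply: le_trans (homle _ _ t'0).
rewrite le_eqVlt; apply/orP; left; apply/eqP; congr plan_inf.
by apply/funext => k; rewrite mulrA mulVf ?gt_eqF// mul1r.
Qed.

(** A deficit is added entirely at [k0]; an excess is removed by proportional shrinking, which keeps
    the weights nonnegative. Either way all changes have the same sign, so their absolute values add
    up to the change of the total. *)
Lemma rescale_sum (K : finType) (k0 : K) (c : K -> R) (p : R) :
  0 <= p -> (forall k, 0 <= c k) -> exists c', [/\ forall k, 0 <= c' k,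
    \sum_k c' k = p & \sum_k `|c' k - c k| = `|p - \sum_k c k| ].
Proof.
move=> p0 c0; set s := \sum_k c k.
have s0 : 0 <= s by exact: sumr_ge0.
have [sp|ps] := leP s p.
  exists (fun k => c k + (if k == k0 then p - s else 0)); split.
  - by move=> k; rewrite addr_ge0//; case: ifP => _; rewrite ?subr_ge0.
  - by rewrite big_split/= -big_mkcond/= big_pred1_eq; rewrite /s addrC subrK.
  - rewrite (bigD1 k0)//= eqxx big1 ?addr0 => [|k /negPf ->].
      by rewrite addrC addKr.
    by rewrite addr0 subrr normr0.
have s_gt0 : 0 < s by exact: le_lt_trans ps.
exists (fun k => c k * (p / s)); split.
- by move=> k; rewrite mulr_ge0// divr_ge0.
- by rewrite -mulr_suml -/s mulrCA divff ?mulr1// gt_eqF.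
- transitivity (\sum_k c k * ((s - p) / s)).
    apply: eq_bigr => k _; rewrite distrC ger0_norm; last first.
      by rewrite subr_ge0 ler_piMr// ler_pdivrMr// mul1r ltW.
    by rewrite -{1}[c k]mulr1 -mulrBr mulrBl divff// gt_eqF.
  rewrite -mulr_suml -/s mulrCA divff ?mulr1 ?gt_eqF//.
  by rewrite distrC gtr0_norm// subr_gt0.
Qed.

(* The penalty is exact: moving mass at [x i] costs at most [`|x i|] per unit. *)
Lemma penalized_cost_exact (i0 : I) (j0 : J) z a b : (forall k, 0 <= z k) ->
  (forall i j, 0 <= a i j) -> (forall i j, 0 <= b i j) ->
  exists a' b', [/\ forall i j, 0 <= a' i j, forall i j, 0 <= b' i j,
    forall i, \sum_j a' i j = z (inl i), forall j, \sum_i b' i j = z (inr j) &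
    plan_cost a' b' <= penalized_cost z a b].
Proof.
move=> z0 a0 b0.
have /choice[a' a'P] i := rescale_sum j0 (z0 (inl i)) (a0 i).
have /choice[b' b'P] j := rescale_sum i0 (z0 (inr j)) (b0^~ j).
exists a', (fun i j => b' j i); split.
- by move=> i j; have [] := a'P i.
- by move=> i j; have [] := b'P j.
- by move=> i; have [] := a'P i.
- by move=> j; have [] := b'P j.
rewrite /penalized_cost.
(* By [rescale_sum] each penalty is a weighted l1 distance between old and new plan, so the bound
   reduces to a triangle inequality for each pair [(i, j)]. *)
have -> : \sum_i `|z (inl i) - \sum_j a i j| * `|x i| =
          \sum_i \sum_j `|a' i j - a i j| * `|x i|.
  by apply: eq_bigr => i _; rewrite -mulr_suml; have [_ _ ->] := a'P i.
have -> : \sum_j `|z (inr j) - \sum_i b i j| * `|y j| =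
          \sum_i \sum_j `|b' j i - b i j| * `|y j|.
  rewrite exchange_big/=.
  by apply: eq_bigr => j _; rewrite -mulr_suml; have [_ _ ->] := b'P j.
rewrite /plan_cost -!big_split ler_sum//= => i _.
rewrite -!big_split ler_sum//= => j _.
rewrite -!normrZ.
have -> : a' i j *: x i - b' j i *: y j = (a i j *: x i - b i j *: y j) +
   (a' i j - a i j) *: x i - (b' j i - b i j) *: y j.
  by rewrite !scalerBl [X in _ = X - _]addrC addrA subrK opprB addrA subrK.
by rewrite (le_trans (ler_normB _ _))// lerD2r ler_normD.
Qed.

(** The slack [e] comes from taking a near-optimal plan; attainment of the minimum would require a
    compactness argument. *)
Lemma homogeneous_duality (i0 : I) (j0 : J) (p : I -> R) (q : J -> R) (e : R) :
  (forall i, 0 <= p i) -> (forall j, 0 <= q j) -> 0 < e ->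
  exists a b (H : V -> R), [/\ forall i j, 0 <= a i j, forall i j, 0 <= b i j,
    forall i, \sum_j a i j = p i & forall j, \sum_i b i j = q j] /\
    [/\ forall (t : R) (z : V), 0 <= t -> H (t *: z) = t * H z,
     forall z w : V, H z - H w <= `|z - w| &
     plan_cost a b <= \sum_i p i * H (x i) - \sum_j q j * H (y j) + e].
Proof.
move=> p0 q0 e0.
pose z0 (k : I + J) : R^o := match k with inl i => p i | inr j => q j end.
pose delta (k : I + J) : I + J -> R^o := fun l => (k == l)%:R.
have decomp (c : I + J -> R^o) : c = \sum_k c k *: delta k.
  apply/funext => l; rewrite fct_sumE (bigD1 l)//= big1 ?addr0 => [|k kl].
    by rewrite -[RHS]/(c l * (l == l)%:R) eqxx mulr1.
  by rewrite -[LHS]/(c k * (k == l)%:R) (negPf kl) mulr0.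
have [f [fle fz0]] := sublinear_support z0 delta sublinear_plan_inf.
have {fz0}fz0 := fz0 z0 (decomp z0).
have {}fle c : \sum_k c k * f k <= plan_inf c.
  by rewrite [in leRHS](decomp c); exact: fle.
pose g j := f (inr j).
have fgle i j s t : 0 <= s -> 0 <= t ->
    s * f (inl i) + t * g j <= `|s *: x i - t *: y j|.
  move=> s0 t0.
  (* The plan concentrated on the single pair [(i, j)] has marginals exactly [c], so both penalties
     vanish and one term of the cost remains. *)
  pose a i' j' : R := if (i' == i) && (j' == j) then s else 0.
  pose b i' j' : R := if (i' == i) && (j' == j) then t else 0.
  pose c (k : I + J) : R :=
    match k with inl i' => if i' == i then s else 0
               | inr j' => if j' == j then t else 0 end.
  have sum1 (K : finType) (k : K) (F : K -> R) :
      (forall k', k' != k -> F k' = 0) -> \sum_k' F k' = F k.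
    by move=> Fk; rewrite (bigD1 k)//= big1 ?addr0.
  have -> : s * f (inl i) + t * g j = \sum_k c k * f k.
    rewrite big_sumType/= (sum1 _ i) ?(sum1 _ j) ?eqxx//.
    - by move=> k' /negPf ->; rewrite mul0r.
    - by move=> k' /negPf ->; rewrite mul0r.
  apply: (le_trans (fle c)); apply: (@le_trans _ _ (penalized_cost c a b)).
    by apply: plan_inf_le => i' j'; rewrite /a /b; case: ifP.
  rewrite /penalized_cost /plan_cost (sum1 _ i); last first.
    move=> i' /negPf ii'; rewrite big1// => j' _.
    by rewrite /a /b ii' !scale0r subr0 normr0.
  rewrite (sum1 _ j); last first.
    by move=> j' /negPf jj'; rewrite /a /b jj' andbF !scale0r subr0 normr0.
  rewrite /a /b !eqxx/= [X in _ + X + _]big1 ?[X in _ + X]big1 ?addr0// => k _.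
  - rewrite (sum1 _ i); last by move=> i' /negPf ->.
    by rewrite eqxx/= subrr normr0 mul0r.
  - rewrite (sum1 _ j); last by move=> j' /negPf ->; rewrite andbF.
    by rewrite eqxx andbT subrr normr0 mul0r.
pose S (z : V) := [set `|z - jt.2 *: y jt.1| - jt.2 * g jt.1 |
              jt in [set jt : J * R | 0 <= jt.2]].
pose H (z : V) := inf (S z).
(* The case [s = 0] of [fgle] bounds [t * g j] by the norm of [t *: y j]; the triangle inequality
   then bounds [S z] below by minus the norm of [z]. *)
have Sinf (z : V) : has_inf (S z).
  split; first by exists (`|z - 0 *: y j0| - 0 * g j0); exists (j0, 0) => /=.
  exists (- `|z|) => _ [[j t] /= t0 <-].
  have := fgle i0 j 0 t (lexx _) t0; rewrite mul0r add0r scale0r sub0r normrN.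
  by have := ler_distD z 0 (t *: y j); rewrite !sub0r !normrN; lra.
have Hle (z : V) j (t : R) : 0 <= t -> H z <= `|z - t *: y j| - t * g j.
  by move=> t0; apply: ge_inf; [exact: (Sinf z).2|exists (j, t)].
have leH (z : V) (m : R) :
    (forall j t, 0 <= t -> m <= `|z - t *: y j| - t * g j) -> m <= H z.
  move=> h; apply: lb_le_inf; first exact: (Sinf z).1.
  by move=> _ [[j t] /= t0 <-]; exact: h.
have Hlip (z w : V) : H z - H w <= `|z - w|.
  rewrite lerBlDl -lerBlDr; apply: leH => j t t0.
  have := Hle z j t t0; have := ler_distD w z (t *: y j); lra.
have Hhomle (t : R) (z : V) : 0 < t -> H (t *: z) <= t * H z.
  move=> t0; rewrite mulrC -ler_pdivrMr//; apply: leH => j s s0.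
  rewrite ler_pdivrMr//.
  apply: (le_trans (Hle _ j (t * s) (mulr_ge0 (ltW t0) s0))).
  by rewrite -scalerA -scalerBr normrZ gtr0_norm//; lra.
have Hhom (t : R) (z : V) : 0 <= t -> H (t *: z) = t * H z.
  rewrite le_eqVlt => /predU1P[<-|t0].
    rewrite scale0r mul0r; apply/eqP; rewrite eq_le; apply/andP; split.
      by have := Hle 0 j0 0 (lexx _); rewrite scale0r subrr normr0 mul0r subrr.
    apply: leH => j s s0; rewrite sub0r normrN.
    by have := fgle i0 j 0 s (lexx _) s0; rewrite mul0r scale0r sub0r normrN; lra.
  apply/eqP; rewrite eq_le Hhomle//=.
  rewrite mulrC -ler_pdivlMr// mulrC.
  have t'0 : 0 < t^-1 by rewrite invr_gt0.
  apply: le_trans (Hhomle _ _ t'0).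
  by rewrite scalerA mulVf ?gt_eqF// scale1r.
(* With [s = 1], [fgle] says that [f (inl i)] is a lower bound of [S (x i)]. For [gH], the element
   of [S (y j)] with parameters [(j, 1)] is [- g j]. *)
have fH i : f (inl i) <= H (x i).
  apply: leH => j t t0.
  by have := fgle i j 1 t ler01 t0; rewrite mul1r scale1r; lra.
have gH j : g j <= - H (y j).
  by have := Hle (y j) j 1 ler01; rewrite scale1r subrr normr0; lra.
have [a [b [a0 b0 ab]]] : exists a b, [/\ forall i j, 0 <= a i j,
    forall i j, 0 <= b i j & penalized_cost z0 a b < plan_inf z0 + e].
  apply: contrapT => h.
  suff : plan_inf z0 + e <= plan_inf z0 by lra.
  apply: le_plan_inf => a b a0 b0; rewrite leNgt; apply/negP => ab.
  by apply: h; exists a, b.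
have z00 k : 0 <= z0 k by case: k.
have [a' [b' [a'0 b'0 a'p b'q cost']]] := penalized_cost_exact i0 j0 z00 a0 b0.
exists a', b', H; split=> //; split=> //.
apply: (le_trans cost'); apply: (le_trans (ltW ab)); rewrite lerD2r.
apply: (le_trans fz0); rewrite big_sumType/= lerD//.
  by apply: ler_sum => i _; exact: ler_wpM2l.
rewrite -sumrN; apply: ler_sum => j _; rewrite -mulrN.
exact: (ler_wpM2l (q0 j) (gH j)).
Qed.

End homogeneous_duality.

(** * Borel measurability and boundedness of continuous functions *)

Lemma open_Borel_measurable (T : ptopologicalType) (A : set T) :
  open A -> measurable (A : set (Borel T)).
Proof. by move=> oA; exact: sub_sigma_algebra. Qed.

Lemma closed_Borel_measurable (T : ptopologicalType) (A : set T) :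
  closed A -> measurable (A : set (Borel T)).
Proof.
by move=> /closed_openC/open_Borel_measurable/measurableC; rewrite setCK.
Qed.

Lemma continuous_Borel_measurable (T U : ptopologicalType) (f : T -> U) :
  continuous f -> measurable_fun setT (f : Borel T -> Borel U).
Proof.
move=> /continuousP cf.
apply: (@measurability _ _ (Borel T) (Borel U) setT f (@open U)) => //.
move=> _ [B oB <-]; rewrite setTI; apply: open_Borel_measurable; exact: cf.
Qed.

Lemma within_continuous_Borel_measurable (R : realType) (T : ptopologicalType)
    (X : set T) (f : T -> R) : closed X -> {within X, continuous f} ->
  measurable_fun (X : set (Borel T)) (f : Borel T -> R).
Proof.
move=> cX /continuousP cf; apply: (measurability _ (RGenOpens.measurableE R)).
move=> _ [_ [a [b ->] <-]].
have /open_subspaceP[B oB] : open (from_subspace X f @^-1` `]a, b[%classic).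
  by apply: cf; exact: interval_open.
move=> BX; have -> : X `&` f @^-1` `]a, b[%classic = B `&` X.
  by rewrite setIC; exact/esym.
apply: measurableI; first exact: open_Borel_measurable.
exact: closed_Borel_measurable.
Qed.

Lemma continuous_Borel_measurableR (R : realType) (T : ptopologicalType)
    (f : T -> R) : continuous f -> measurable_fun setT (f : Borel T -> R).
Proof.
move=> cf; apply: within_continuous_Borel_measurable => //.
exact: continuous_subspaceT.
Qed.

Lemma within_continuous_compact_bounded (R : realType) (T : ptopologicalType)
    (X : set T) (f : T -> R) : compact X -> {within X, continuous f} ->
  exists M, forall x, X x -> `|f x| <= M.
Proof.
move=> cX cf; have /compact_bounded := continuous_compact cf cX.
move=> [M [_ h]]; exists (M + 1) => x Xx.
by apply: (h (M + 1)); [rewrite ltrDl | exists x].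
Qed.

Lemma bounded_onP (R : realType) (T : Type) (A : set T) (f : T -> R) (M : R) :
  (forall x, A x -> `|f x| <= M) -> [bounded f x | x in A].
Proof.
move=> h; exists M; split; first exact: num_real.
by move=> y My x Ax; exact: le_trans (h x Ax) (ltW My).
Qed.

(** * Integrability on [XXII X] and the direct inequalities *)

Section easy_inequalities.
Context {R : realType} {V : normedModType R}.
Variables (X : set V) (hX : compact X).
Local Notation W := (V * V * R * R)%type.

Lemma compact_closedX : closed X.
Proof. exact: compact_closed. Qed.

Lemma compact_measurableX : measurable (X : set (Borel V)).
Proof. by apply: closed_Borel_measurable; exact: compact_closedX. Qed.

Lemma continuous_prx : continuous (fun p : W => p.1.1.1).
Proof.
move=> p; apply: (@continuous_comp W (V * V * R)%type V fst (fun q => q.1.1)).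
  exact: cvg_fst.
apply: (@continuous_comp (V * V * R)%type (V * V)%type V fst fst); exact: cvg_fst.
Qed.

Lemma continuous_pry : continuous (fun p : W => p.1.1.2).
Proof.
move=> p; apply: (@continuous_comp W (V * V * R)%type V fst (fun q => q.1.2)).
  exact: cvg_fst.
apply: (@continuous_comp (V * V * R)%type (V * V)%type V fst snd).
  exact: cvg_fst.
exact: cvg_snd.
Qed.

Lemma continuous_prl : continuous (fun p : W => p.1.2).
Proof.
move=> p; apply: (@continuous_comp W (V * V * R)%type R fst snd).
  exact: cvg_fst.
exact: cvg_snd.
Qed.

Lemma continuous_prm : continuous (fun p : W => p.2).
Proof. by move=> p; apply: cvg_snd. Qed.

Lemma measurable_XXII : measurable (XXII X).
Proof.
have -> : XXII X = ((fun p : W => p.1.1.1) @^-1` X) `&`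
  ((fun p : W => p.1.1.2) @^-1` X) `&`
  ((fun p : W => p.1.2) @^-1` `[0, 1]%classic) `&`
  ((fun p : W => p.2) @^-1` `[0, 1]%classic).
  apply/seteqP; split => p; rewrite /XXII/= !in_itv/=.
    by move=> [? [? [? ?]]]; repeat split.
  by move=> [[[? ?] ?] ?]; repeat split.
have cl (U : topologicalType) (f : W -> U) A :
    continuous f -> closed A -> closed (f @^-1` A).
  by move=> /continuous_closedP; exact.
apply: (@closed_Borel_measurable (W : normedModType R)); repeat apply: closedI.
- by apply: cl; [exact: continuous_prx|exact: compact_closedX].
- by apply: cl; [exact: continuous_pry|exact: compact_closedX].
- by apply: cl; [exact: continuous_prl|exact: itv_closed].
- by apply: cl; [exact: continuous_prm|exact: itv_closed].
Qed.

Lemma measurable_contX f : contX X f ->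
  measurable_fun (X : set (Borel V)) (f : Borel V -> R).
Proof.
move=> cf; apply: within_continuous_Borel_measurable => //.
exact: compact_closedX.
Qed.

(** Stated for measurable [f] because it also serves for the positive and negative parts of a
    continuous function. *)
Lemma measurable_lambda_f f :
  measurable_fun (X : set (Borel V)) (f : Borel V -> R) ->
  measurable_fun (XXII X) (fun p : Borel W => p.1.2 * f p.1.1.1).
Proof.
move=> mf; apply: measurable_funM.
  apply: measurable_funTS.
  apply: (@continuous_Borel_measurableR R (W : normedModType R)).
  exact: continuous_prl.
apply: (@measurable_comp _ _ _ (Borel W) (Borel V) _ X f) => //.
- exact: compact_measurableX.
- by move=> _ [p [Xp _] <-].
- apply: measurable_funTS.
  apply: (@continuous_Borel_measurable (W : normedModType R)).
  exact: continuous_prx.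
Qed.

Lemma measurable_mu_f f :
  measurable_fun (X : set (Borel V)) (f : Borel V -> R) ->
  measurable_fun (XXII X) (fun p : Borel W => p.2 * f p.1.1.2).
Proof.
move=> mf; apply: measurable_funM.
  apply: measurable_funTS.
  apply: (@continuous_Borel_measurableR R (W : normedModType R)).
  exact: continuous_prm.
apply: (@measurable_comp _ _ _ (Borel W) (Borel V) _ X f) => //.
- exact: compact_measurableX.
- by move=> _ [p [_ [Xp _]] <-].
- apply: measurable_funTS.
  apply: (@continuous_Borel_measurable (W : normedModType R)).
  exact: continuous_pry.
Qed.

Definition cost (p : W) : R := `|p.1.2 *: p.1.1.1 - p.2 *: p.1.1.2|.

Lemma continuous_cost : continuous cost.
Proof.
move=> p; apply: cvg_norm; apply: cvgB; apply: cvgZ.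
- exact: continuous_prl.
- exact: continuous_prx.
- exact: continuous_prm.
- exact: continuous_pry.
Qed.

Lemma measurable_cost D : measurable_fun D (cost : Borel W -> R).
Proof.
apply: measurable_funTS; apply: (@continuous_Borel_measurableR R (W : normedModType R)).
exact: continuous_cost.
Qed.

Lemma integrable_XXII (g : {finite_measure set (Borel W) -> \bar R})
    (F : W -> R) (M : R) : measurable_fun (XXII X) (F : Borel W -> R) ->
  (forall p, XXII X p -> `|F p| <= M) ->
  g.-integrable (XXII X) (EFin \o F).
Proof.
move=> mF FM; apply: measurable_bounded_integrable => //.
- exact: measurable_XXII.
- by rewrite -ge0_fin_numE// fin_num_measure//; exact: measurable_XXII.
- exact: bounded_onP FM.
Qed.

Lemma normXXII_le (a M y : R) : 0 <= a <= 1 -> `|y| <= M -> `|a * y| <= M.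
Proof.
move=> /andP[a0 a1] yM; rewrite normrM (ger0_norm a0) (le_trans _ yM)//.
by rewrite ler_piMl.
Qed.

Lemma integrable_lambda_f (g : {finite_measure set (Borel W) -> \bar R}) f :
  contX X f -> g.-integrable (XXII X) (EFin \o (fun p : W => p.1.2 * f p.1.1.1)).
Proof.
move=> cf; have [M fM] := within_continuous_compact_bounded hX cf.
apply: (@integrable_XXII _ _ M); first exact: measurable_lambda_f (measurable_contX cf).
by move=> p [Xp [_ [lp _]]]; apply: normXXII_le => //; exact: fM.
Qed.

Lemma integrable_mu_f (g : {finite_measure set (Borel W) -> \bar R}) f :
  contX X f -> g.-integrable (XXII X) (EFin \o (fun p : W => p.2 * f p.1.1.2)).
Proof.
move=> cf; have [M fM] := within_continuous_compact_bounded hX cf.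
apply: (@integrable_XXII _ _ M); first exact: measurable_mu_f (measurable_contX cf).
by move=> p [_ [Xp [_ mp]]]; apply: normXXII_le => //; exact: fM.
Qed.

Lemma integrable_cost (g : {finite_measure set (Borel W) -> \bar R}) :
  g.-integrable (XXII X) (EFin \o cost).
Proof.
have [M [_ XM]] := compact_bounded hX.
have {}XM x : X x -> `|x| <= M + 1 by apply: XM; rewrite ltrDl.
apply: (@integrable_XXII _ _ ((M + 1) + (M + 1))); first exact: measurable_cost.
move=> p [Xx [Xy [lp mp]]]; rewrite normr_id (le_trans (ler_normB _ _))//.
have nZ (a : R) (x : V) : 0 <= a <= 1 -> X x -> `|a *: x| <= M + 1.
  move=> /andP[a0 a1] Xz; rewrite normrZ ger0_norm// (le_trans _ (XM _ Xz))//.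
  by rewrite ler_piMl.
by rewrite lerD ?nZ.
Qed.

Lemma D2_sub_D2eps e : 0 < e -> D2 X `<=` D2eps X e.
Proof.
move=> e0 fg [cf [cg h]]; split=> //; split=> //.
move=> x y Xx Xy a b /andP[a0 _] /andP[b0 _].
by apply: le_trans (h x y Xx Xy a b a0 b0) _; rewrite lerDr ltW.
Qed.

Lemma d2_le_d2plus u v : (d2 X u v <= d2plus X u v)%E.
Proof.
apply/ereal_infP => _ [e /= e0 <-]; apply: ge_ereal_sup => _ [fg h <-].
by apply: ereal_sup_ubound; exists fg => //; exact: D2_sub_D2eps.
Qed.

Lemma integrable_contX (u : {finite_measure set (Borel V) -> \bar R}) f :
  contX X f -> u.-integrable (X : set (Borel V)) (EFin \o f).
Proof.
move=> cf; have [M fM] := within_continuous_compact_bounded hX cf.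
apply: measurable_bounded_integrable.
- exact: compact_measurableX.
- by rewrite -ge0_fin_numE// fin_num_measure//; exact: compact_measurableX.
- exact: measurable_contX.
- exact: bounded_onP fM.
Qed.

Lemma contXN f : contX X f -> contX X (fun x => - f x).
Proof. by move=> cf x; apply: cvgN; exact: cf. Qed.

Lemma integXN (u : probability (Borel V) R) f : contX X f ->
  integX X u (fun x => - f x) = (- integX X u f)%E.
Proof.
move=> cf; rewrite /integX -mulN1e.
rewrite -(integralZl compact_measurableX (integrable_contX u cf)).
by apply: eq_integral => x _; rewrite /= -EFinM mulN1r.
Qed.

Lemma d1_le_d2 u v : (d1 X u v <= d2 X u v)%E.
Proof.
apply: ge_ereal_sup => _ [f [cf h] <-].
apply: ereal_sup_ubound; exists (f, fun x => - f x); last by rewrite integXN.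
split=> //; split; first exact: contXN.
by move=> x y Xx Xy a b a0 b0; rewrite /= mulrN h.
Qed.

Lemma d2plus_le_d3 u v : (d2plus X u v <= d3 X u v)%E.
Proof.
apply/ereal_infP => _ [g [_ [gu gv]] <-].
have mD := measurable_XXII.
have icost : (\int[g]_(p in XXII X) (cost p)%:E)%E \is a fin_num.
  exact: integrable_fin_num (integrable_cost g).
have gfin : g (XXII X) \is a fin_num by exact: fin_num_measure.
apply/lee_addgt0Pr => e e0; pose m := fine (g (XXII X)).
have m0 : 0 <= m by rewrite fine_ge0.
(* The parameter of [D2eps] gets integrated against [g], which multiplies it by the mass [m]; adding
   1 keeps the denominator positive, and the product stays below [e]. *)
have e'0 : 0 < e / (m + 1) by rewrite divr_gt0// ltr_wpDl.
apply: (@le_trans _ _ (d2eps X (e / (m + 1)) u v)).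
  by apply: ereal_inf_lbound; exists (e / (m + 1)).
apply: ge_ereal_sup => _ [[f h] [/= cf [ch fh]] <-].
(* The marginal conditions turn the dual value into one integral over [g], whose integrand is
   bounded pointwise by the constraint [fh]. *)
rewrite -gu// -gv// -integralD//; last 2 first.
- exact: integrable_lambda_f.
- exact: integrable_mu_f.
apply: (@le_trans _ _ (\int[g]_(p in XXII X) ((e / (m + 1))%:E + (cost p)%:E))%E).
  apply: le_integral => //.
  - by apply: integrableD => //; [exact: integrable_lambda_f|exact: integrable_mu_f].
  - apply: integrableD => //; last exact: integrable_cost.
    exact: finite_measure_integrable_cst.
  - move=> p /set_mem [Xx [Xy [lp mp]]]; rewrite -!EFinD lee_fin; exact: fh.
rewrite integralD//; last 2 first.
- exact: finite_measure_integrable_cst.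
- exact: integrable_cost.
rewrite addeC leeD2l// integral_cst// [X in (_ * X)%E](_ : _ = m%:E); last first.
  by rewrite /m fineK.
rewrite -EFinM lee_fin.
by rewrite mulrAC ler_pdivrMr ?ltr_wpDl// mulrDr mulr1 lerDl ltW.
Qed.

End easy_inequalities.

(** * Borel sets and the product sigma-algebra over a compact set *)

Lemma continuous_pair (T U U' : topologicalType) (f : T -> U) (g : T -> U') :
  continuous f -> continuous g -> continuous (fun x => (f x, g x)).
Proof. by move=> cf cg x; exact: cvg_pair (cf x) (cg x). Qed.

Section product_Borel.
Context {R : realType} {V : normedModType R}.
Variables (X : set V) (hX : compact X).
Local Notation W := (V * V * R * R)%type.

Lemma compact_finite_net (e : R) : 0 < e -> exists s : seq V,
  {in s, forall y, X y} /\ forall x, X x -> exists2 y, y \in s & ball y e x.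
Proof.
move=> e0; move: hX; rewrite compact_cover => cX.
have [|x Xx|D DX XD] := cX V X (fun x => ball x e).
- by move=> x _; exact: ball_open.
- by exists x => //; exact: ballxx.
exists (finmap.enum_fset D); split=> [y yD|x Xx].
  by have := DX y yD; rewrite inE.
by have [y yD yx] := XD x Xx; exists y.
Qed.

(* The Borel sets of V * V may exceed the product sigma-algebra (V need not be
   separable), but not on X * X. *)
Lemma measurable_setX_open (O : set (V * V)) : open O ->
  measurable ((X `*` X) `&` O : set (Borel V * Borel V)).
Proof.
move=> oO.
have invS_gt0 (k : nat) : 0 < k.+1%:R^-1 :> R by rewrite invr_gt0.
have /choice[s sP] k := compact_finite_net (invS_gt0 k).
pose B k (q : V * V) := ball q.1 k.+1%:R^-1 `*` ball q.2 k.+1%:R^-1.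
pose D k := [set q : V * V | [/\ q.1 \in s k, q.2 \in s k & B k q `<=` O]].
(* Each [D k] is finite, since its centres are taken in the net [s k]; so [O] is exhausted on
   [X * X] by countably many measurable rectangles. *)
have -> : (X `*` X) `&` O = (X `*` X) `&` \bigcup_k \bigcup_(q in D k) B k q.
  apply/seteqP; split=> [[x y] [[/= Xx Xy] Oxy]|z [Xz [k _ [q [_ _]]]]]; last first.
    by move=> BO Bz; split=> //; exact: BO.
  split=> //; have := open_nbhs_nbhs (conj oO Oxy).
  move=> [[A1 A2] [/= /nbhs_ballP[e1 /= e10 eA1] /nbhs_ballP[e2 /= e20 eA2] AO]].
  (* Half the smaller radius, because a point of the ball around the net point [x'] is only within
     two radii of [x], and likewise for [y]. *)
  have e0 : 0 < Num.min e1 e2 / 2 by rewrite divr_gt0// lt_min e10.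
  have [k _ /(_ _ (leqnn k)) ke] := near_infty_natSinv_lt (PosNum e0).
  exists k => //; have {}ke : k.+1%:R^-1 + k.+1%:R^-1 <= Num.min e1 e2 :> R.
    have /ltW : k.+1%:R^-1 < Num.min e1 e2 / 2 := ke.
    by rewrite ler_pdivlMr// mulr_natr mulr2n.
  have [x' xs xx'] := (sP k).2 _ Xx; have [y' ys yy'] := (sP k).2 _ Xy.
  exists (x', y'); last by split.
  split=> // -[z w] [/= x'z y'w]; apply: AO; split => /=.
  - apply: eA1; apply: (@le_ball _ _ _ (k.+1%:R^-1 + k.+1%:R^-1)).
      by rewrite (le_trans ke)// ge_min lexx.
    by apply: ball_triangle x'z; exact: ball_sym.
  - apply: eA2; apply: (@le_ball _ _ _ (k.+1%:R^-1 + k.+1%:R^-1)).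
      by rewrite (le_trans ke)// ge_min lexx orbT.
    by apply: ball_triangle y'w; exact: ball_sym.
apply: measurableI.
  by apply: measurableX; exact: compact_measurableX.
apply: bigcupT_measurable => k; apply: fin_bigcup_measurable.
  apply: (@sub_finite_set _ _ [set` [seq (a, b) | a <- s k, b <- s k]]).
    by move=> [a b] /= [asE bs _]; apply/allpairsP; exists (a, b).
  exact: finite_seq.
by move=> q _; apply: measurableX; apply: open_Borel_measurable; exact: ball_open.
Qed.

Variables (x0 : V) (Xx0 : X x0).

(* Retraction onto [X], so that [plan_embed] takes all its values in [XXII X]. *)
Definition clamp (x : V) : V := if x \in X then x else x0.

Lemma clampX x : X (clamp x).
Proof. by rewrite /clamp; case: ifPn => //; rewrite inE. Qed.

Lemma clamp_id x : X x -> clamp x = x.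
Proof. by move=> Xx; rewrite /clamp mem_set. Qed.

Lemma measurable_clamp : measurable_fun setT (clamp : Borel V -> Borel V).
Proof.
move=> _ B mB; rewrite setTI.
have mX := compact_measurableX hX.
have -> : clamp @^-1` B = (X `&` B) `|` (~` X `&` [set _ | B x0]).
  apply/seteqP; split=> x /=; rewrite /clamp.
    case: ifPn => xX; first by move: xX; rewrite inE => ? ?; left.
    by move: xX; rewrite notin_setE => ? ?; right.
  by case=> [[Xx Bx]|[nXx Bx0]]; [rewrite mem_set|rewrite memNset].
apply: measurableU; first exact: measurableI.
apply: measurableI; first exact: measurableC.
have [Bx0|nBx0] := pselect (B x0).
  by rewrite (_ : [set _ | _] = setT)//; apply/seteqP; split.
by rewrite (_ : [set _ | _] = set0)//; apply/seteqP; split.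
Qed.

Definition plan_embed (a b : R) (z : V * V) : W := (clamp z.1, clamp z.2, a, b).

(** The source carries the product sigma-algebra, the target the Borel one. Clamping first makes
    only the trace on [X * X] of an open set matter, and [measurable_setX_open] applies to that
    trace. *)
Lemma measurable_plan_embed a b :
  measurable_fun setT (plan_embed a b : Borel V * Borel V -> Borel W).
Proof.
apply: (@measurability _ _ (Borel V * Borel V)%type (Borel W) setT _ (@open W)) => //.
move=> _ [ O oO <-]; rewrite setTI.
pose O' := [set z : V * V | O (z.1, z.2, a, b)].
have oO' : open O'.
  have cj : continuous (fun z : V * V => (z.1, z.2, a, b) : W).
    apply: continuous_pair; last exact: cst_continuous.
    apply: continuous_pair; last exact: cst_continuous.
    by apply: continuous_pair => z; [exact: cvg_fst|exact: cvg_snd].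
  by move/continuousP : cj; apply.
have -> : plan_embed a b @^-1` O =
   (fun z => (clamp z.1, clamp z.2)) @^-1` ((X `*` X) `&` O').
  apply/seteqP; split=> z /=; rewrite /plan_embed/=; last by case.
  by move=> Oz; split=> //; split; exact: clampX.
have mcc : measurable_fun setT
    (fun z : Borel V * Borel V => (clamp z.1, clamp z.2) : Borel V * Borel V).
  apply: measurable_fun_pair.
    exact: (@measurableT_comp _ _ _ _ (Borel V) (Borel V) clamp setT fst
      measurable_clamp).
  exact: (@measurableT_comp _ _ _ _ (Borel V) (Borel V) clamp setT snd
    measurable_clamp).
rewrite -[X in measurable X]setTI; apply: mcc => //.
exact: measurable_setX_open.
Qed.

End product_Borel.

(** * Finite sums, products and conditioning of measures *)

Section finite_sum_of_measures.
Local Open Scope ereal_scope.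
Context d (T : measurableType d) (R : realType) (I : finType) (i0 : I).
Variable m : I -> {measure set T -> \bar R}.

Definition mfinsum : {measure set T -> \bar R} :=
  msum (fun k => m (nth i0 (enum I) k)) #|I|.

Lemma sum_nth_enum (F : I -> \bar R) :
  \sum_(k < #|I|) F (nth i0 (enum I) k) = \sum_i F i.
Proof. by rewrite -[RHS]big_enum (big_nth i0) big_mkord -cardE. Qed.

Lemma mfinsumE A : mfinsum A = \sum_i m i A.
Proof. by rewrite -sum_nth_enum. Qed.

Lemma ge0_integral_mfinsum D (f : T -> \bar R) : measurable D ->
  measurable_fun D f -> (forall x, D x -> 0 <= f x) ->
  \int[mfinsum]_(x in D) f x = \sum_i \int[m i]_(x in D) f x.
Proof.
move=> mD mf f0; rewrite ge0_integral_measure_sum//.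
by rewrite (sum_nth_enum (fun i => \int[m i]_(x in D) f x)).
Qed.

End finite_sum_of_measures.

(** [M3] ranges over bundled finite measures, whereas [mfinsum] yields a plain measure. *)
Lemma finite_measure_of d (T : measurableType d) (R : realType)
    (m : {measure set T -> \bar R}) : fin_num_fun m ->
  exists g : {finite_measure set T -> \bar R}, forall A, g A = m A.
Proof.
move=> mfin.
pose fin_mixin := isFinite.Build _ _ _ _ mfin.
have sfin : sigma_finite setT m.
  by apply: fin_num_fun_sigma_finite => //; rewrite measure0.
pose sfin_mixin := isSFinite.Build _ _ _ _ (sfinite_measure_sigma_finite sfin).
pose sigma_fin_mixin := isSigmaFinite.Build _ _ _ _ sfin.
pose g := HB.pack_for (FiniteMeasure.type T R) (Measure.sort m)
  fin_mixin sfin_mixin sigma_fin_mixin.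
by exists g.
Qed.

Section product_probability.
Local Open Scope ereal_scope.
Context d1 d2 (T1 : measurableType d1) (T2 : measurableType d2) (R : realType).
Variables (P : probability T1 R) (Q : probability T2 R).

Lemma product_probability_setT : (P \x Q) setT = 1.
Proof.
rewrite -setXTT product_measure1E// [X in X * _]probability_setT mul1e.
by rewrite [LHS]probability_setT.
Qed.

Lemma ge0_integral_product_fst (h : T1 -> \bar R) : measurable_fun setT h ->
  (forall x, 0 <= h x) -> \int[P \x Q]_z h z.1 = \int[P]_x h x.
Proof.
move=> mh h0; rewrite (@fubini_tonelli1 _ _ _ _ _ _ _ (h \o fst)); last 2 first.
- exact: measurableT_comp.
- by move=> z; exact: h0.
apply: eq_integral => x _; rewrite /fubini_F/= integral_cst//.
by rewrite [X in _ * X]probability_setT mule1.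
Qed.

Lemma ge0_integral_product_snd (h : T2 -> \bar R) : measurable_fun setT h ->
  (forall x, 0 <= h x) -> \int[P \x Q]_z h z.2 = \int[Q]_x h x.
Proof.
move=> mh h0; rewrite (@fubini_tonelli2 _ _ _ _ _ _ _ (h \o snd)); last 2 first.
- exact: measurableT_comp.
- by move=> z; exact: h0.
apply: eq_integral => x _; rewrite /fubini_G/= integral_cst//.
by rewrite [X in _ * X]probability_setT mule1.
Qed.

End product_probability.

Section conditional_law.
Local Open Scope ereal_scope.
Context d (T : measurableType d) (R : realType) (u : probability T R).
Variables (A : set T) (mA : measurable A) (x : T).

(* Conditioning on a null cell gives the Dirac mass at [x]. *)
Definition cond_law : probability T R := mnormalize (mrestr u mA) (\d_x).

(** The multiplied form also covers a null cell [A], where both sides vanish. *)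
Lemma cond_lawE B : measurable B -> u A * cond_law B = u (B `&` A).
Proof.
move=> mB; rewrite /cond_law/= /mnormalize/= /mrestr setTI.
have uA : u A \is a fin_num by exact: fin_num_measure.
case: ifPn => [/orP[/eqP uA0|/eqP uAoo]|].
- rewrite uA0 mul0e; apply/esym/eqP; rewrite eq_le measure_ge0 andbT.
  by rewrite -uA0 le_measure ?inE//; exact: measurableI.
- by rewrite uAoo in uA.
- rewrite negb_or => /andP[uA0 _]; rewrite muleCA -{1}(fineK uA) -EFinM divff ?mule1//.
  by rewrite fine_eq0.
Qed.

(** The condition [B x] handles the null cell, whose law is the Dirac mass at [x]. *)
Lemma cond_law_full B : measurable B -> A `<=` B -> B x -> cond_law B = 1.
Proof.
move=> mB AB Bx; rewrite /cond_law/= /mnormalize/= /mrestr setTI.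
have uA : u A \is a fin_num by exact: fin_num_measure.
case: ifPn => [_|]; first by rewrite diracE mem_set.
rewrite negb_or => /andP[uA0 _]; rewrite (setIidr AB).
by rewrite -{1}(fineK uA) -EFinM divff// fine_eq0.
Qed.

Lemma ge0_integral_cond_law (h : T -> \bar R) : measurable_fun setT h ->
  (forall y, 0 <= h y) -> u A * \int[cond_law]_y h y = \int[u]_(y in A) h y.
Proof.
move=> mh h0; have mhA : measurable_fun A h by exact: measurable_funTS.
have uA : u A \is a fin_num by exact: fin_num_measure.
have [uA0|uA0] := eqVneq (u A) 0.
  by rewrite uA0 mul0e null_set_integral.
have lawC : cond_law (~` A) = 0.
  have := cond_lawE (measurableC mA); rewrite setICl measure0 => /eqP.
  by rewrite mule_eq0 (negPf uA0)/= => /eqP.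
rewrite (ge0_negligible_integral (measurableC mA) measurableT mh _ lawC)//.
rewrite setTD setCK -(fineK uA).
have uA_ge0 : (0 <= fine (u A))%R by exact: fine_ge0.
rewrite -[X in X%:E * _]/((NngNum uA_ge0)%:num)%R -ge0_integral_mscale//.
apply: eq_measure_integral => B mB BA.
by rewrite /= /mscale/= fineK// cond_lawE// (setIidl BA).
Qed.

End conditional_law.

(** * Lifting discrete weights to a measure on [XXII X] *)

Section plan_measure.
Context {R : realType} {V : normedModType R}.
Variables (X : set V) (hX : compact X) (x0 : V) (Xx0 : X x0).
Local Notation W := (V * V * R * R)%type.
Variables (I J : finType) (i0 : I) (j0 : J).
Variables (P : I -> probability (Borel V) R) (Q : J -> probability (Borel V) R).
Variables (a b : I -> J -> R).
Hypothesis a01 : forall i j, 0 <= a i j <= 1.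
Hypothesis b01 : forall i j, 0 <= b i j <= 1.

Let embed i j : Borel V * Borel V -> Borel W := plan_embed X x0 (a i j) (b i j).

Lemma plan_embedXXII i j z : XXII X (embed i j z).
Proof.
split; first exact: clampX.
by split; [exact: clampX|split; [exact: a01|exact: b01]].
Qed.

Let push (k : I * J) : {measure set (Borel W) -> \bar R} :=
  measure_function_pushforward__canonical__measure_function_Measure
    (P k.1 \x Q k.2)%E (measurable_plan_embed hX Xx0 (a k.1 k.2) (b k.1 k.2)).

(** Every pair [(i, j)] contributes mass one: the weights enter only as the coordinates
    [lambda = a i j] and [mu = b i j]. The total mass is the number of pairs, which is allowed
    because [M3] asks for finite measures, not probabilities. *)
Lemma plan_measure : exists g : {finite_measure set (Borel W) -> \bar R},
  g (~` XXII X) = 0%E /\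
  forall G : W -> \bar R, measurable_fun (XXII X) (G : Borel W -> \bar R) ->
    (forall p, XXII X p -> 0 <= G p)%E ->
    (\int[g]_(p in XXII X) G p =
     \sum_i \sum_j \int[P i \x Q j]_z G (embed i j z))%E.
Proof.
pose m := mfinsum (i0, j0) push.
have mXXII : measurable (XXII X) by exact: measurable_XXII.
have preT k A : XXII X `<=` A -> embed k.1 k.2 @^-1` A = setT.
  by move=> XA; apply/seteqP; split=> // z _; apply: XA; exact: plan_embedXXII.
have mfin : fin_num_fun m.
  apply: lty_fin_num_fun; rewrite mfinsumE; apply/lte_sum_pinfty => k _.
  rewrite [X in (X < _)%E](_ : _ = 1%E) ?ltry//.
  rewrite /= /pushforward preimage_setT; exact: product_probability_setT.
have [g gm] := finite_measure_of mfin.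
exists g; split.
  rewrite gm mfinsumE big1// => k _.
  rewrite /= /pushforward [X in product_measure1 _ _ X](_ : _ = set0) ?measure0//.
  by rewrite -preimage_setC preT// setCT.
move=> G mG G0; rewrite (eq_measure_integral m) => [|A _ _]; last exact: gm.
rewrite ge0_integral_mfinsum// pair_bigA; apply: eq_bigr => k _.
rewrite ge0_integral_pushforward//; last first.
- by move=> p /set_mem; exact: G0.
- exact: measurable_plan_embed.
by rewrite (preT k).
Qed.

End plan_measure.

(** * Partition of [X] into small cells and quadrature *)

Lemma lipschitz1_continuous (R : realType) (V : normedModType R) (H : V -> R) :
  (forall z w, H z - H w <= `|z - w|) -> continuous H.
Proof.
move=> Hlip x; apply/cvgrPdist_le => e e0; near=> y.
have xy : `|x - y| <= e by near: y; apply: cvgr_dist_le.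
rewrite (le_trans _ xy)// ler_norml (Hlip x y) andbT lerNl opprB.
by rewrite distrC.
Unshelve. all: by end_near. Qed.

Section discretization.
Context {R : realType} {V : normedModType R}.
Variables (X : set V) (hX : compact X).
Local Notation W := (V * V * R * R)%type.

(** The balls of a finite net are made disjoint by removing the earlier ones, so a cell may be empty
    or miss its point [x i]. The index type ['I_n.+1] is inhabited because [X] is nonempty. *)
Lemma compact_cells (e : R) : X !=set0 -> 0 < e ->
  exists n (x : 'I_n.+1 -> V) (A : 'I_n.+1 -> set (Borel V)),
  [/\ forall i, X (x i), forall i, measurable (A i), trivIset setT A,
    \big[setU/set0]_i A i = X & forall i z, A i z -> `|z - x i| <= e].
Proof.
move=> [x0 Xx0] e0; have [s [sX sP]] := compact_finite_net hX e0.
case: s => [|y s] in sX sP; first by have [] := sP _ Xx0.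
pose B k : set (Borel V) := ball (nth y (y :: s) k) e.
have mB k : measurable (B k) by apply: open_Borel_measurable; exact: ball_open.
exists (size s), (fun i => nth y (y :: s) i), (fun i => X `&` seqDU B i).
split.
- by move=> i; apply: sX; rewrite mem_nth.
- move=> i; apply: measurableI; first exact: compact_measurableX.
  by rewrite /seqDU; apply: measurableD => //; exact: bigsetU_measurable.
- apply/trivIsetP => i j _ _ ij; rewrite setIACA.
  have /trivIsetP -> // := trivIset_seqDU B; first by rewrite setI0.
- rewrite -big_distrr/= -bigsetU_seqDU; apply/setIidPl => x Xx.
  have [z zs zx] := sP x Xx.
  have zlt : (index z (y :: s) < (size s).+1)%N by rewrite index_mem.
  rewrite -bigcup_mkord; exists (index z (y :: s)) => //=.
  by rewrite /B nth_index.
- move=> i z [_ [+ _]]; rewrite /B -ball_normE/= distrC; exact: ltW.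
Qed.

Variables (I : finType) (A : I -> set (Borel V)).
Hypothesis mA : forall i, measurable (A i).
Hypothesis tA : trivIset setT A.
Hypothesis AX : \big[setU/set0]_i A i = X.

Lemma cell_subset i : A i `<=` X.
Proof.
by rewrite -AX -bigcup_seq => z Az; exists i => //=; exact: mem_index_enum.
Qed.

Lemma integral_cells (u : {measure set (Borel V) -> \bar R}) (f : V -> R) :
  measurable_fun (X : set (Borel V)) (f : Borel V -> R) ->
  (\int[u]_(z in (X : set (Borel V))) (f z)%:E =
   \sum_i \int[u]_(z in A i) (f z)%:E)%E.
Proof.
rewrite -[in X in X -> _]AX -[in X in _ -> X = _]AX => mf.
rewrite integral_bigsetU_EFin//; first exact: index_enum_uniq.
  exact: sub_trivIset tA.
exact/measurable_EFinP.
Qed.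

Lemma sum_cells (u : probability (Borel V) R) : Delta X u ->
  \sum_i fine (u (A i)) = 1.
Proof.
move=> uX.
have cstE B : measurable B -> (\int[u]_(z in B) 1%:E = (fine (u B))%:E)%E.
  by move=> mB; rewrite integral_cst// mul1e fineK// fin_num_measure.
have := integral_cells u (measurable_cst (1 : R)).
rewrite cstE ?(eq_bigr _ (fun i _ => cstE _ (mA i))); last exact: compact_measurableX.
by rewrite sumEFin uX => -[].
Qed.

(** On [A i] the Lipschitz bound gives [f >= f (x i) - e], and the cells have total mass 1. The
    matching upper bound is this lemma for the opposite function. *)
Lemma quadrature_le (u : probability (Borel V) R) (x : I -> V) (e : R)
    (f : V -> R) : Delta X u -> contX X f ->
  (forall z w, f z - f w <= `|z - w|) ->
  (forall i z, A i z -> `|z - x i| <= e) ->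
  ((\sum_i fine (u (A i)) * f (x i) - e)%:E <= integX X u f)%E.
Proof.
move=> uX cf flip Ae.
rewrite /integX integral_cells; last exact: measurable_contX.
have -> : \sum_i fine (u (A i)) * f (x i) - e =
    \sum_i fine (u (A i)) * (f (x i) - e).
  rewrite -[in LHS](mul1r e) -(sum_cells uX) mulr_suml -sumrB.
  by apply: eq_bigr => i _; rewrite mulrBr.
rewrite -sumEFin; apply: lee_sum => i _.
have uA : u (A i) \is a fin_num by exact: fin_num_measure.
have -> : ((fine (u (A i)) * (f (x i) - e))%:E =
    \int[u]_(z in A i) (f (x i) - e)%:E)%E.
  by rewrite integral_cst// EFinM fineK// muleC.
apply: le_integral => //.
- exact: finite_measure_integrable_cst.
- apply: (integrableS (compact_measurableX hX)) => //; first exact: cell_subset.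
  exact: integrable_contX.
- move=> z /set_mem Az; rewrite lee_fin lerBlDr -lerBlDl.
  by rewrite (le_trans (flip _ _))// distrC Ae.
Qed.

End discretization.

Lemma integral_posneg (R : realType) (d : measure_display) (T : measurableType d)
    (m : {measure set T -> \bar R}) D (F : T -> R) :
  (\int[m]_(p in D) (F p)%:E = \int[m]_(p in D) (F^\+ p)%:E
     - \int[m]_(p in D) (F^\- p)%:E)%E.
Proof.
by rewrite integralE -!/(EFin \o F) funerpos funerneg.
Qed.

(** * Admissibility and cost of the lifted plan *)

Section discrete_upper_bound.
Context {R : realType} {V : normedModType R}.
Variables (X : set V) (hX : compact X).
Local Notation W := (V * V * R * R)%type.
Variables (I : finType) (i0 : I) (A : I -> set (Borel V)) (x : I -> V) (e : R).
Hypothesis mA : forall i, measurable (A i).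
Hypothesis tA : trivIset setT A.
Hypothesis AX : \big[setU/set0]_i A i = X.
Hypothesis e0 : 0 <= e.
Hypothesis Xx : forall i, X (x i).
Hypothesis Ae : forall i z, A i z -> `|z - x i| <= e.

Let clampx := clamp X (x i0).

Lemma measurable_comp_clamp (f : V -> R) :
  measurable_fun (X : set (Borel V)) (f : Borel V -> R) ->
  measurable_fun setT (fun z : Borel V => (f (clampx z))%:E).
Proof.
move=> mf; apply/measurable_EFinP.
apply: (@measurable_comp _ _ _ (Borel V) (Borel V) _ X f) => //.
- exact: compact_measurableX.
- by move=> _ [z _ <-]; exact: clampX.
- exact: measurable_clamp.
Qed.

(** The marginal condition for the lifted plan: the row sum of [c] at [i] is the mass of [A i], and
    that mass times the conditional law is [u] restricted to [A i]. *)
Lemma sum_cond_law (u : probability (Borel V) R) (c : I -> I -> R) (f : V -> R) :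
  (forall i j, 0 <= c i j) -> (forall i, \sum_j c i j = fine (u (A i))) ->
  measurable_fun (X : set (Borel V)) (f : Borel V -> R) ->
  (forall z, X z -> 0 <= f z) ->
  (\sum_i \sum_j (c i j)%:E *
     \int[cond_law u (mA i) (x i)]_z (f (clampx z))%:E = integX X u f)%E.
Proof.
move=> c0 cu mf f0; rewrite /integX (integral_cells mA tA AX)//.
apply: eq_bigr => i _; rewrite -ge0_sume_distrl//; last first.
  by move=> j _; rewrite lee_fin.
rewrite sumEFin cu fineK ?fin_num_measure// ge0_integral_cond_law.
- apply: eq_integral => z /set_mem Az; rewrite /clampx clamp_id//.
  exact: (cell_subset AX Az).
- exact: measurable_comp_clamp.
- by move=> z; rewrite lee_fin f0//; exact: clampX.
Qed.

Variables (u v : probability (Borel V) R) (a b : I -> I -> R).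
Hypothesis a0 : forall i j, 0 <= a i j.
Hypothesis b0 : forall i j, 0 <= b i j.
Hypothesis au : forall i, \sum_j a i j = fine (u (A i)).
Hypothesis bv : forall j, \sum_i b i j = fine (v (A j)).

Lemma d3_le_plan_cost : Delta X u -> Delta X v ->
  (d3 X u v <= (plan_cost x x a b + (e + e))%:E)%E.
Proof.
move=> uX vX.
(* Weights at most 1 are what allows [a i j] and [b i j] to serve as [lambda] and [mu]. *)
have sumle1 (w : probability (Borel V) R) i : Delta X w -> fine (w (A i)) <= 1.
  move=> wX; rewrite -(sum_cells hX mA tA AX wX) (bigD1 i)//= lerDl.
  by apply: sumr_ge0 => j _; exact: fine_ge0.
have a01 i j : 0 <= a i j <= 1.
  rewrite a0/= (le_trans _ (sumle1 u i uX))// -au (bigD1 j)//= lerDl.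
  by apply: sumr_ge0 => k _; exact: a0.
have b01 i j : 0 <= b i j <= 1.
  rewrite b0/= (le_trans _ (sumle1 v j vX))// -bv (bigD1 i)//= lerDl.
  by apply: sumr_ge0 => k _; exact: b0.
pose P i := cond_law u (mA i) (x i).
pose Q j := cond_law v (mA j) (x j).
have [g [gX gE]] := plan_measure hX (Xx i0) i0 i0 P Q a01 b01.
have margu_pos f : measurable_fun (X : set (Borel V)) (f : Borel V -> R) ->
    (forall z, X z -> 0 <= f z) ->
    (\int[g]_(p in XXII X) (p.1.2 * f p.1.1.1)%:E = integX X u f)%E.
  move=> mf f0; rewrite gE; last 2 first.
  - by apply/measurable_EFinP; exact: measurable_lambda_f.
  - by move=> p [Xp [_ [/andP[lp _] _]]]; rewrite lee_fin mulr_ge0// f0.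
  rewrite -(sum_cond_law a0 au mf f0).
  apply: eq_bigr => i _; apply: eq_bigr => j _.
  have mh := measurable_comp_clamp mf.
  have h0 z : (0 <= (f (clampx z))%:E)%E by rewrite lee_fin f0//; exact: clampX.
  rewrite -(ge0_integral_product_fst (P i) (Q j) mh h0) -ge0_integralZl ?lee_fin//.
  exact: (measurableT_comp mh measurable_fst).
have margv_pos f : measurable_fun (X : set (Borel V)) (f : Borel V -> R) ->
    (forall z, X z -> 0 <= f z) ->
    (\int[g]_(p in XXII X) (p.2 * f p.1.1.2)%:E = integX X v f)%E.
  move=> mf f0; rewrite gE; last 2 first.
  - by apply/measurable_EFinP; exact: measurable_mu_f.
  - by move=> p [_ [Xp [_ /andP[lp _]]]]; rewrite lee_fin mulr_ge0// f0.
  rewrite exchange_big/= -(sum_cond_law (fun j i => b0 i j) bv mf f0).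
  apply: eq_bigr => j _; apply: eq_bigr => i _.
  have mh := measurable_comp_clamp mf.
  have h0 z : (0 <= (f (clampx z))%:E)%E by rewrite lee_fin f0//; exact: clampX.
  rewrite -(ge0_integral_product_snd (P i) (Q j) mh h0) -ge0_integralZl ?lee_fin//.
  exact: (measurableT_comp mh measurable_snd).
(* The marginals are known for nonnegative functions only; a general [f] is split into its positive
   and negative parts, which commute with the factors [lambda, mu >= 0]. *)
have gM3 : M3 X u v g.
  split=> //; split=> f cf.
    have mf := measurable_contX hX cf.
    rewrite integral_posneg /integX [RHS]integral_posneg.
    rewrite -[X in _ = (X - _)%E]margu_pos; last 2 first.
    - exact: measurable_funrpos.
    - by move=> z _; exact: funrpos_ge0.
    rewrite -[X in _ = (_ - X)%E]margu_pos; last 2 first.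
    - exact: measurable_funrneg.
    - by move=> z _; exact: funrneg_ge0.
    congr (_ - _)%E; apply: eq_integral => p /set_mem [_ [_ [/andP[lp _] _]]].
      by rewrite /funrpos maxr_pMr// mulr0.
    by rewrite /funrneg maxr_pMr// mulr0 mulrN.
  have mf := measurable_contX hX cf.
  rewrite integral_posneg /integX [RHS]integral_posneg.
  rewrite -[X in _ = (X - _)%E]margv_pos; last 2 first.
  - exact: measurable_funrpos.
  - by move=> z _; exact: funrpos_ge0.
  rewrite -[X in _ = (_ - X)%E]margv_pos; last 2 first.
  - exact: measurable_funrneg.
  - by move=> z _; exact: funrneg_ge0.
  congr (_ - _)%E; apply: eq_integral => p /set_mem [_ [_ [_ /andP[lp _]]]].
    by rewrite /funrpos maxr_pMr// mulr0.
  by rewrite /funrneg maxr_pMr// mulr0 mulrN.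
apply: (@le_trans _ _ (\int[g]_(p in XXII X) (cost p)%:E)%E).
  by apply: ereal_inf_lbound; exists g.
rewrite gE; last 2 first.
- by apply/measurable_EFinP; exact: measurable_cost.
- by move=> p _; rewrite lee_fin /cost.
(* The cell [A i] is enlarged so as to contain [x i]: then the conditional law has full mass on
   [B i] even when [A i] is null. Staying inside [X] makes [clamp] the identity there. *)
pose B i : set (Borel V) := X `&` [set z | `|z - x i| <= e].
have mB i : measurable (B i).
  apply: measurableI; first exact: compact_measurableX.
  apply: closed_Borel_measurable.
  rewrite (_ : [set z | _] = (fun z => `|z - x i|) @^-1` [set r | r <= e])//.
  have : continuous (fun z : V => `|z - x i|).
    by move=> z; apply: cvg_norm; apply: cvgB; [exact: cvg_id|exact: cvg_cst].
  by move/continuous_closedP; apply; exact: closed_le.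
have AB i : A i `<=` B i.
  by move=> z Az; split; [exact: (cell_subset AX Az)|exact: Ae].
have Bx i : B i (x i) by split => //=; rewrite subrr normr0.
have PQB i j : ((P i \x Q j) (~` (B i `*` B j)) = 0)%E.
  have mBB : measurable (B i `*` B j : set (Borel V * Borel V)).
    exact: measurableX.
  have mass : ((P i \x Q j) (B i `*` B j) = 1)%E.
    rewrite product_measure1E// [X in (X * _)%E](cond_law_full u (mA i) (mB i))//.
    by rewrite mul1e [LHS](cond_law_full v (mA j) (mB j)).
  have : ((P i \x Q j) (~` (B i `*` B j)) + (P i \x Q j) (B i `*` B j) = 1)%E.
    rewrite -measureU//; last by rewrite setICl.
      by rewrite setvU; exact: product_probability_setT.
    exact: measurableC.
  by rewrite mass => /(congr1 (fun r => r - 1)%E); rewrite addeK// subee.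
(* Moving both points by at most [e] costs [a i j * e + b i j * e] on the pair [(i, j)]; since [a]
   and [b] each have total sum 1, this adds up to [e + e]. *)
apply: (@le_trans _ _ (\sum_i \sum_j
  (`|a i j *: x i - b i j *: x j| + (a i j * e + b i j * e))%:E)%E); last first.
  rewrite (eq_bigr _ (fun i _ => sumEFin _ _ _)) sumEFin lee_fin.
  rewrite (eq_bigr _ (fun i _ => big_split _ _ _ _ _)) big_split/= lerD2l.
  rewrite (eq_bigr _ (fun i _ => big_split _ _ _ _ _)) big_split/= lerD//.
    rewrite (eq_bigr _ (fun i _ => esym (mulr_suml _ _ _ _))) -mulr_suml.
    by rewrite (eq_bigr _ (fun i _ => au i)) (sum_cells hX mA tA AX uX) mul1r.
  rewrite exchange_big/= (eq_bigr _ (fun i _ => esym (mulr_suml _ _ _ _))).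
  rewrite -mulr_suml.
  by rewrite (eq_bigr _ (fun i _ => bv i)) (sum_cells hX mA tA AX vX) mul1r.
apply: lee_sum => i _; apply: lee_sum => j _.
set C := (X in (_ <= X%:E)%E).
have C0 : 0 <= C.
  by rewrite /C !addr_ge0// mulr_ge0.
have -> : (C%:E = \int[P i \x Q j]_z cst C%:E z)%E.
  by rewrite integral_cst// [X in (_ * X)%E]product_probability_setT mule1.
apply: ae_ge0_le_integral => //.
- by move=> z _; rewrite lee_fin /cost.
- apply/measurable_EFinP.
  apply: (@measurableT_comp _ _ _ _ (Borel W) _ cost setT).
    exact: measurable_cost.
  exact: measurable_plan_embed.
exists (~` (B i `*` B j)); split.
- by apply: measurableC; exact: measurableX.
- exact: PQB.
apply: subsetC => z [[Xz1 z1e] [Xz2 z2e]] _; rewrite lee_fin /cost/= !clamp_id//.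
rewrite /C; have -> : a i j *: z.1 - b i j *: z.2 = a i j *: x i - b i j *: x j +
    (a i j *: (z.1 - x i) - b i j *: (z.2 - x j)).
  by rewrite !scalerBr opprB addrACA addKr [X in _ = X + _]addrC subrK.
rewrite (le_trans (ler_normD _ _))// lerD2l (le_trans (ler_normB _ _))//.
by rewrite !normrZ !ger0_norm// lerD// ler_wpM2l.
Qed.

End discrete_upper_bound.

(** * The reverse inequality and the conclusion *)

Lemma d3_le_d1 (R : realType) (V : normedModType R) (X : set V)
    (u v : probability (Borel V) R) :
  compact X -> Delta X u -> Delta X v -> (d3 X u v <= d1 X u v)%E.
Proof.
move=> hX uX vX; apply/lee_addgt0Pr => e e0.
have X0 : X !=set0.
  apply/set0P/eqP => X0; have : u (X : set (Borel V)) = 1%E by [].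
  by rewrite X0 measure0 => /eqP; rewrite eq_sym onee_eq0.
(* Five errors add up: two from lifting the plan, one from its near-optimality and one quadrature
   error for each of [u] and [v]. *)
have d0 : 0 < e / 5 by rewrite divr_gt0.
have [n [x [A [Xx mA tA AX Ae]]]] := compact_cells hX X0 d0.
have p0 (w : probability (Borel V) R) i : 0 <= fine (w (A i)) by exact: fine_ge0.
have [a [b [H [[a0 b0 au bv] [Hhom Hlip cost_le]]]]] :=
  homogeneous_duality x x ord0 ord0 (p0 u) (p0 v) d0.
have := d3_le_plan_cost hX ord0 mA tA AX (ltW d0) Xx Ae a0 b0 au bv uX vX.
move=> /le_trans; apply.
have cH : contX X H.
  by apply: continuous_subspaceT; exact: lipschitz1_continuous.
have HN z w : - H z - - H w <= `|z - w|.
  by rewrite distrC opprK addrC; exact: Hlip.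
have qu := quadrature_le hX mA tA AX uX cH Hlip Ae.
have := quadrature_le hX mA tA AX vX (contXN cH) HN Ae.
rewrite integXN// => qv.
have ufin : integX X u H \is a fin_num.
  apply: integrable_fin_num; [exact: compact_measurableX|exact: integrable_contX].
have vfin : integX X v H \is a fin_num.
  apply: integrable_fin_num; [exact: compact_measurableX|exact: integrable_contX].
(* Homogeneity moves the factors [s] and [t] inside [H], where the constraint is the Lipschitz
   bound. *)
have HD1 : D1 X H.
  split=> // y z Xy Xz s t s0 t0; rewrite -!Hhom//; exact: Hlip.
apply: (@le_trans _ _ (integX X u H - integX X v H + e%:E)%E); last first.
  by rewrite leeD2r//; apply: ereal_sup_ubound; exists H.
have sumN : \sum_i fine (v (A i)) * - H (x i) = - \sum_i fine (v (A i)) * H (x i).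
  by rewrite -sumrN; apply: eq_bigr => i _; rewrite mulrN.
move: qu qv; rewrite sumN -(fineK ufin) -(fineK vfin) -!EFinN -!EFinD !lee_fin.
by move: cost_le; lra.
Qed.

Theorem theorem1 (R : realType) (V : normedModType R) (X : set V)
  (hX : compact X) (u v : probability (Borel V) R)
  (hu : Delta X u) (hv : Delta X v) :
  d1 X u v = d2 X u v /\ d2 X u v = d2plus X u v /\ d2plus X u v = d3 X u v.
Proof.
have le12 := d1_le_d2 hX u v; have le22 := d2_le_d2plus X u v.
have le23 := d2plus_le_d3 hX u v; have le31 := d3_le_d1 hX hu hv.
split; last split; apply/le_anti/andP; split=> //.
- exact: le_trans le22 (le_trans le23 le31).
- exact: le_trans le23 (le_trans le31 le12).
- exact: le_trans le31 (le_trans le12 le22).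
Qed.
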